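(* Let $n$ be a positive integer. For any $K\in\mathcal{K}^n$ and any integer $m\ge 3$ we have $\breve w_m(K)=w_m(K)$.
   Context: $\mathcal{K}^n$ denotes the class of $n$-dimensional convex bodies, i.e. compact convex subsets of $\mathbb{R}^n$ with nonempty interior. For $K\in\mathcal{K}^n$, $C(K)$ is the space of continuous real-valued functions on $K$ with norm $\|f\|_K=\max_{x\in K}|f(x)|$, and $\breve C(K)$ is the set of those $f\in C(K)$ that are convex on $K$, i.e. satisfy $f(x)+f(y)\ge 2f((x+y)/2)$ for all $x,y\in K$. $\mathcal{P}_{m,n}$ is the space of real algebraic polynomials of total degree $\le m$ in $n$ variables. For $f\in C(K)$, \[ E_m(f;K)=\inf_{P\in\mathcal{P}_{m,n}}\|f-P\|_K, \] and the $m$-th modulus of smoothness is \[ \omega_m(f;K)=\max_{x,x+h,\dots,x+mh\in K}|\Delta_h^m(f;x)|,\qquad \Delta_h^m(f;x)=\sum_{j=0}^m(-1)^j\binom mj f(x+jh), \] the maximum being over all $x,h\in\mathbb{R}^n$ with $x,x+h,\dots,x+mh\in K$. The Whitney constant and the Whitney constant for convex functions are, respectively, \[ w_m(K)=\sup\{E_{m-1}(f;K): f\in C(K),\ \omega_m(f;K)\le 1\}, \] \[ \breve w_m(K)=\sup\{E_{m-1}(f;K): f\in\breve C(K),\ \omega_m(f;K)\le 1\}. \] *)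

(* Defs.v *)
From HB Require Import structures.
From mathcomp Require Import all_boot all_order all_algebra.
From mathcomp Require Import all_classical all_reals all_analysis.
From mathcomp Require mpoly.

(* The notations of mpoly clash with those of mathcomp-analysis, hence
   [mpoly n R] below instead of the bracketed notation. *)
Import -(notations) mpoly.
Import Order.TTheory GRing.Theory Num.Theory numFieldNormedType.Exports.

Set Implicit Arguments.
Unset Strict Implicit.
Unset Printing Implicit Defensive.

Local Open Scope classical_set_scope.
Local Open Scope ring_scope.

(* The norm on ['rV[R]_n] is the sup norm; it is used only through the topology
   it induces, which is the usual one. *)
Definition convex_body (R : realType) (n : nat) (K : set 'rV[R]_n) : Prop :=
  [/\ compact K, convex_set K & K° !=set0].

(* An element of C(K) is represented by any total function whose restriction to
   K is continuous; everything below depends only on the values on K. *)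
Definition cont_on (R : realType) (n : nat) (K : set 'rV[R]_n) :
    set ('rV[R]_n -> R) :=
  [set f | {within K, continuous f}].

Definition convex_cont_on (R : realType) (n : nat) (K : set 'rV[R]_n) :
    set ('rV[R]_n -> R) :=
  [set f | cont_on K f /\
    forall x y, K x -> K y -> f x + f y >= 2 * f (2^-1 *: (x + y))].

(* For f continuous on a convex body K the suprema in [unorm] and [omega] are
   finite and attained. *)
Definition unorm (R : realType) (n : nat) (K : set 'rV[R]_n)
    (f : 'rV[R]_n -> R) : \bar R :=
  ereal_sup [set `|f x|%:E | x in K].

Definition peval (R : realType) (n : nat) (p : mpoly n R) (x : 'rV[R]_n) : R :=
  meval (fun i => x ord0 i) p.

(* [msize p] is the total degree plus one, and 0 if p = 0. *)
Definition polys (R : realType) (m n : nat) : set (mpoly n R) :=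
  [set p | (msize p <= m.+1)%N].
Arguments polys : clear implicits.

Definition best_approx (R : realType) (n m : nat) (f : 'rV[R]_n -> R)
    (K : set 'rV[R]_n) : \bar R :=
  ereal_inf [set unorm K (fun x => f x - peval p x) | p in polys R m n].

Definition fdiff (R : realType) (n m : nat) (h : 'rV[R]_n)
    (f : 'rV[R]_n -> R) (x : 'rV[R]_n) : R :=
  \sum_(j < m.+1) (-1) ^+ j * 'C(m, j)%:R * f (x + j%:R *: h).

Definition omega (R : realType) (n m : nat) (f : 'rV[R]_n -> R)
    (K : set 'rV[R]_n) : \bar R :=
  ereal_sup [set e | exists x h : 'rV[R]_n,
    (forall j, (j <= m)%N -> K (x + j%:R *: h)) /\ e = `|fdiff m h f x|%:E].

Definition whitney (R : realType) (n m : nat) (K : set 'rV[R]_n) : \bar R :=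
  ereal_sup [set best_approx m.-1 f K |
    f in [set f | cont_on K f /\ (omega m f K <= 1)%E]].

Definition convex_whitney (R : realType) (n m : nat) (K : set 'rV[R]_n) :
    \bar R :=
  ereal_sup [set best_approx m.-1 f K |
    f in [set f | convex_cont_on K f /\ (omega m f K <= 1)%E]].

(* Main.v *)
Require Import Defs.
From mathcomp Require Import all_boot all_order all_algebra.
From mathcomp Require Import all_classical all_reals all_analysis.
From mathcomp Require Import ring lra.
From mathcomp Require mpoly.

Import -(notations) mpoly.
Import Order.TTheory GRing.Theory Num.Theory numFieldNormedType.Exports.

(** The Whitney constant for convex functions is a supremum over a smaller
class, so only [whitney m K <= convex_whitney m K] needs an argument. For [m >= 3] both
the [m]-th modulus of smoothness and the distance to polynomials of degree
[m - 1] are unchanged when a multiple of the squared Euclidean norm is added to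
the function. Hence every function that becomes convex after adding some
[l * |x|^2] (a semiconvex function) counts as a convex one, and it suffices to
approximate an arbitrary continuous [f] uniformly on [K] by semiconvex functions.

The approximation is the sup-convolution with a paraboloid,
[x |-> sup_(y in K) (f y - l * |x - y|^2)]. After adding [l * |x|^2] it is a
supremum of functions affine in [x], hence convex, and uniformly Lipschitz since
[K] is bounded, hence continuous ([envelope_convex_cont]). On [K] it lies above
[f] (take [y = x]), and as [l] grows it exceeds [f] by at most any given [e]
([parabola_le_near]): if [y] is close to [x], then [f y] is close to [f x], and
otherwise the term [l * |x - y|^2] outweighs the oscillation of [f].

An approximation within [e] has modulus of smoothness at most [1 + 2^m * e], so
it is divided by this number before it is compared with the convex constant;
the loss caused by the division and by the error [e] vanishes as [e] tends to 0
([omega_rescale], [best_approx_rescale]). *)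

Set Implicit Arguments.
Unset Strict Implicit.
Unset Printing Implicit Defensive.

Local Open Scope classical_set_scope.
Local Open Scope ring_scope.

(** * Finite differences and the squared norm *)

Definition sqnorm (R : realType) (n : nat) (x : 'rV[R]_n) : R :=
  \sum_(i < n) x ord0 i ^+ 2.

Section Fdiff.
Variables (R : realType) (n : nat).
Implicit Types (f g : 'rV[R]_n -> R) (x h : 'rV[R]_n).

(** Pascal's rule, in the form that lets the order of the difference be lowered
by differencing the function once. *)
Lemma fdiffS m h f x :
  fdiff m.+1 h f x = fdiff m h (fun y => f y - f (y + h)) x.
Proof.
pose t j := (-1) ^+ j * 'C(m, j)%:R * f (x + j%:R *: h).
have -> : fdiff m h (fun y => f y - f (y + h)) x =
    \sum_(j < m.+1) t j
    - \sum_(j < m.+1) (-1) ^+ j * 'C(m, j)%:R * f (x + j.+1%:R *: h).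
  rewrite -sumrB; apply: eq_bigr => j _.
  by rewrite mulrBr -addrA -[in LHS](scale1r h) scalerA mulr1 -scalerDl natr1.
have -> : \sum_(j < m.+1) t j = \sum_(j < m.+2) t j.
  by rewrite [RHS]big_ord_recr /= /t bin_small// mulr0 mul0r addr0.
rewrite /fdiff [LHS]big_ord_recl [in RHS]big_ord_recl /= -addrA -sumrB /t !bin0.
congr (_ + _).
by apply: eq_bigr => j _; rewrite /bump /= add1n binS natrD exprS; ring.
Qed.

Lemma fdiff_lin m h (a b : R) f g x :
  fdiff m h (fun y => a * f y + b * g y) x =
  a * fdiff m h f x + b * fdiff m h g x.
Proof.
by rewrite /fdiff !mulr_sumr -big_split; apply: eq_bigr => j _ /=; ring.
Qed.

(** A third difference of a polynomial of degree 2 vanishes identically. *)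
Lemma fdiff_sqnorm m h x : (3 <= m)%N -> fdiff m h (@sqnorm R n) x = 0.
Proof.
case: m => [|[|[|m]]]// _; rewrite !fdiffS /fdiff big1// => j _.
rewrite /sqnorm -!sumrB big1 ?mulr0// => i _; rewrite !mxE; ring.
Qed.

(** The binomial coefficients of order [m] sum to [2 ^ m]. *)
Lemma fdiff_le m h f x (e : R) :
  (forall j, (j <= m)%N -> `|f (x + j%:R *: h)| <= e) ->
  `|fdiff m h f x| <= 2 ^+ m * e.
Proof.
move=> fe; apply: le_trans (ler_norm_sum _ _ _) _.
have -> : 2 ^+ m = \sum_(j < m.+1) 'C(m, j)%:R :> R.
  rewrite -natrX -[2%N]/(1 + 1)%N expnDn natr_sum.
  by apply: eq_bigr => j _; rewrite !exp1n !muln1.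
rewrite mulr_suml; apply: ler_sum => j _.
rewrite normrM normrMsign (ger0_norm (ler0n _ _)).
by rewrite ler_wpM2l// fe// -ltnS.
Qed.

End Fdiff.

Lemma coord_le_norm (R : realType) n (x : 'rV[R]_n) i : `|x ord0 i| <= `|x|.
Proof.
rewrite [leRHS]/Num.norm /= mx_normrE.
exact: (le_bigmax _ (fun ij : 'I_1 * 'I_n => `|x ij.1 ij.2|) (ord0, i)).
Qed.

Lemma sqnorm_ge0 (R : realType) n (x : 'rV[R]_n) : 0 <= sqnorm x.
Proof. by apply: sumr_ge0 => i _; exact: sqr_ge0. Qed.

(** The topology comes from the sup norm; through this comparison the paraboloid
is bounded below away from its vertex. *)
Lemma sqr_norm_le_sqnorm (R : realType) n (x : 'rV[R]_n) :
  `|x| ^+ 2 <= sqnorm x.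
Proof.
have [->|x0] := eqVneq `|x| 0; first by rewrite expr0n sqnorm_ge0.
have [[i j] xE] := mx_norm_neq0 x0.
rewrite [`|x|]xE (ord1 i) /= real_normK ?num_real// /sqnorm (bigD1 j)//=.
by rewrite lerDl sumr_ge0// => k _; exact: sqr_ge0.
Qed.

Lemma peval_sqnorm (R : realType) n :
  exists2 q : mpoly n R, polys R 2 n q & forall x, peval q x = sqnorm x.
Proof.
exists (\sum_(i < n) mpolyX R (mnm_muln (mnm1 i) 2)).
  rewrite /polys/=; apply: leq_trans (msize_sum _ _ _) _.
  by apply/bigmax_leqP => i _; rewrite msizeX mdegMn mdeg1.
move=> x; rewrite /peval raddf_sum/=; apply: eq_bigr => i _.
rewrite mevalX (bigD1 i)//= big1 ?mulr1.
  by rewrite mulmnE mnm1E eqxx mul1n.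
by move=> j ji; rewrite mulmnE mnm1E eq_sym (negbTE ji) mul0n expr0.
Qed.

(** * Uniform approximation by semiconvex functions *)

Lemma compact_norm_bound (R : realType) (V : normedModType R) (A : set V) :
  compact A -> exists2 B, 0 <= B & forall y, A y -> `|y| <= B.
Proof.
move=> /compact_bounded/pinfty_ex_gt0[B B0 AB].
by exists B => [|y Ay]; [exact: ltW | exact: AB].
Qed.

(** In coordinates this is [l * (2 * <x, y> - |y|^2)], the affine function
tangent to [l * |x|^2] at [y]; written this way, adding [f y] and subtracting
[l * |x|^2] visibly gives [f y - l * |x - y|^2]. *)
Definition tangent (R : realType) n (l : R) (y x : 'rV[R]_n) : R :=
  l * (sqnorm x - sqnorm (x - y)).

(** The sup-convolution of [f] on [K] with the paraboloid, plus [l * |x|^2]. *)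
Definition envelope (R : realType) n (l : R) (K : set 'rV[R]_n) f
    (x : 'rV[R]_n) :=
  sup [set f y + tangent l y x | y in K].

(** The parallelogram identity, which expresses that the tangent is affine. *)
Lemma tangent_midpoint (R : realType) n (l : R) (y x z : 'rV[R]_n) :
  tangent l y x + tangent l y z = 2 * tangent l y (2^-1 *: (x + z)).
Proof.
rewrite /tangent /sqnorm -!sumrB -mulrDr -big_split [RHS]mulrCA; congr (_ * _).
rewrite mulr_sumr.
by apply: eq_bigr => i _; rewrite !mxE /=; field.
Qed.

(** The constant depends on [y] only through the bound [C], so it passes to the
supremum over a bounded set of [y]. *)
Lemma tangent_lipschitz (R : realType) n (l C : R) (y x z : 'rV[R]_n) :
  0 <= l -> `|y| <= C ->
  tangent l y x <= tangent l y z + l * (n%:R * (2 * C)) * `|x - z|.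
Proof.
move=> l0 yC; rewrite -lerBlDl -mulrBr -mulrA ler_wpM2l// /sqnorm -!sumrB.
rewrite -mulrA mulr_natl -[X in _ *+ X]card_ord -sumr_const.
apply: ler_sum => i _.
apply: (@le_trans _ _ (2 * (y ord0 i * (x - z) ord0 i))).
  by rewrite !mxE le_eqVlt; apply/orP; left; apply/eqP; ring.
rewrite -mulrA ler_wpM2l//; apply: le_trans (ler_norm _) _.
rewrite normrM ler_pM// ?coord_le_norm//.
exact: le_trans (coord_le_norm _ _) yC.
Qed.

(** Near a point [x0], the continuity of [f] at [x0] bounds [f y - f x] for [y]
close to [x0]; for the other [y], which stay away from [x], the squared norm is
bounded below and a large [l] makes up for any oscillation of [f]. Compactness
of [K] turns this local choice of [l] into a uniform one. *)
Lemma parabola_le_near (R : realType) n (K : set 'rV[R]_n) f (e : R) :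
  compact K -> cont_on K f -> 0 < e ->
  \forall l \near +oo, forall x, K x -> forall y, K y ->
    f y - l * sqnorm (x - y) <= f x + e.
Proof.
move=> Kcpt fcont e0.
have [B B0 fB] := compact_norm_bound (continuous_compact fcont Kcpt).
have {}fB y : K y -> `|f y| <= B by move=> Ky; apply: fB; exists y.
move/subspace_continuousP : fcont => fcont.
(* The covering form of compactness is stated for an inclusion of [K]. *)
suff : \forall l \near +oo,
    K `<=` (fun x => forall y, K y -> f y - l * sqnorm (x - y) <= f x + e).
  by [].
apply: (near_covering_withinP K).2; first exact/compact_near_coveringP.
move=> x0 Kx0.
have /cvgrPdist_le/(_ (e / 2)) := fcont _ Kx0.
rewrite divr_gt0// => /(_ isT)/nbhs_ballP[d /= d0 dP].
have {}dP z : K z -> `|x0 - z| < d -> `|f x0 - f z| <= e / 2.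
  by move=> Kz zd; apply: dP => //; rewrite -ball_normE.
(* The radius is halved so that [y] outside [ball x0 d] is at distance at least
   [d / 2] from [x]; then [l * sqnorm (x - y)] is at least [2 * B], which bounds
   every difference [f y - f x]. *)
exists (ball x0 (d / 2), [set l | 2 * B / (d / 2) ^+ 2 <= l]).
  split; first by apply: nbhsx_ballx; rewrite divr_gt0.
  by apply: nbhs_pinfty_ge; rewrite num_real.
move=> [x l] /= [+ lB] Kx y Ky; rewrite -ball_normE/= => x0x.
have d20 : 0 < (d / 2) ^+ 2 by rewrite exprn_gt0// divr_gt0.
have l0 : 0 <= l.
  by apply: le_trans lB; rewrite divr_ge0// ?mulr_ge0// ltW.
have := fB _ Kx; have := fB _ Ky; rewrite !ler_norml => /andP[_ fy] /andP[fx _].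
have [yd|yd] := ltP `|x0 - y| d.
  have := dP _ Ky yd; have := dP x Kx; rewrite !ler_norml => /(_ _)/andP.
  have := mulr_ge0 l0 (sqnorm_ge0 (x - y)).
  move=> h /(_ (lt_trans x0x _)); rewrite ltr_pdivrMr// ltr_pMr// ltr1n.
  by move=> /(_ isT)[? ?] /andP[? ?]; lra.
have xy : d / 2 <= `|x - y|.
  by have := ler_distD x x0 y; lra.
have : 2 * B <= l * sqnorm (x - y).
  rewrite -(divfK (lt0r_neq0 d20) (2 * B)).
  apply: ler_pM => //; [|exact: ltW|].
    by apply: divr_ge0; [exact: mulr_ge0|exact: ltW].
  apply: le_trans (sqr_norm_le_sqnorm _).
  by rewrite lerXn2r// ?nnegrE// divr_ge0// ltW.
by lra.
Qed.

Section Envelope.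
Variables (R : realType) (n : nat) (K : set 'rV[R]_n) (f : 'rV[R]_n -> R).
Hypotheses (K0 : K !=set0) (Kcpt : compact K) (fcont : cont_on K f).
Variable l : R.
Hypothesis l0 : 0 <= l.

Lemma envelope_has_sup x : has_sup [set f y + tangent l y x | y in K].
Proof.
split; first by case: K0 => y Ky; exists (f y + tangent l y x), y.
have [B _ fB] := compact_norm_bound (continuous_compact fcont Kcpt).
have [C _ KC] := compact_norm_bound Kcpt.
exists (B + l * (n%:R * (2 * C)) * `|x|) => _ [y Ky <-].
apply: lerD; first by apply: le_trans (ler_norm _) _; apply: fB; exists y.
have := tangent_lipschitz x 0 l0 (KC _ Ky); rewrite subr0 => /le_trans; apply.
rewrite gerDr mulr_ge0_le0// subr_le0.
by rewrite [leLHS]big1 ?sqnorm_ge0// => i _; rewrite mxE expr0n.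
Qed.

Lemma le_envelope x y : K y -> f y + tangent l y x <= envelope l K f x.
Proof.
by move=> Ky; apply: ub_le_sup; [case: (envelope_has_sup x)|exists y].
Qed.

Lemma envelope_le x b :
  (forall y, K y -> f y + tangent l y x <= b) -> envelope l K f x <= b.
Proof.
move=> fb; apply: ge_sup => [|_ [y Ky <-]]; last exact: fb.
by case: (envelope_has_sup x).
Qed.

Lemma envelope_convex_cont : convex_cont_on K (envelope l K f).
Proof.
split; last first.
  move=> x z _ _; rewrite -ler_pdivlMl//; apply: envelope_le => y Ky.
  rewrite ler_pdivlMl// mulrDr -tangent_midpoint.
  by have := le_envelope x Ky; have := le_envelope z Ky; lra.
apply: continuous_subspaceT => x.
have [C C0 KC] := compact_norm_bound Kcpt.
set L := l * (n%:R * (2 * C)).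
have L0 : 0 <= L by rewrite !mulr_ge0.
have lip u v : envelope l K f u <= envelope l K f v + L * `|u - v|.
  apply: envelope_le => y Ky.
  have := tangent_lipschitz u v l0 (KC _ Ky); have := le_envelope v Ky.
  by rewrite -/L; lra.
apply: (cvgrPdist_le (F := nbhs x) _ _).2 => e e0; apply/nbhs_ballP.
exists (e / (L + 1)) => /= [|z]; first by rewrite divr_gt0// ltr_wpDl.
rewrite -ball_normE/= ltr_pdivlMr ?ltr_wpDl// => xz.
have := lip x z; have := lip z x; rewrite distrC => h1 h2.
have : L * `|x - z| <= e by have := normr_ge0 (x - z); lra.
by move=> h; rewrite ler_norml; apply/andP; split; lra.
Qed.

End Envelope.

Lemma semiconvex_approx (R : realType) n (K : set 'rV[R]_n) f (e : R) :
  K !=set0 -> compact K -> cont_on K f -> 0 < e ->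
  exists l g, convex_cont_on K g /\
    forall x, K x -> `|g x - l * sqnorm x - f x| <= e.
Proof.
move=> K0 Kcpt fcont e0.
have [l l0 lP] := pinfty_ex_gt0 (parabola_le_near Kcpt fcont e0).
exists l, (envelope l K f); split; first exact: envelope_convex_cont (ltW l0).
move=> x Kx; have := le_envelope K0 Kcpt fcont (ltW l0) x Kx.
have : envelope l K f x <= f x + e + l * sqnorm x.
  apply: envelope_le => // [|y Ky]; first exact: ltW.
  by have := lP x Kx y Ky; rewrite /tangent; lra.
rewrite /tangent subrr [sqnorm 0]big1; last by move=> i _; rewrite mxE expr0n.
by rewrite subr0 ler_norml => ? ?; apply/andP; split; lra.
Qed.

(** * Comparison of the Whitney constants *)

Section Transfer.
Variables (R : realType) (n m : nat) (K : set 'rV[R]_n) (f g : 'rV[R]_n -> R).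
Variables (l e : R).
Hypothesis gP : forall x, K x -> `|g x - l * sqnorm x - f x| <= e.
Hypothesis e0 : 0 <= e.
Let s := 1 + 2 ^+ m * e.

Let s_gt0 : 0 < s.
Proof. by rewrite ltr_pwDl// mulr_ge0// exprn_ge0. Qed.

(** Differences of order at least 3 see [g] only through [f] and the error, and
the error contributes at most [2 ^ m * e]. *)
Lemma omega_rescale : (3 <= m)%N -> (omega m f K <= 1)%E ->
  (omega m (fun x => (s^-1 * g x)%R) K <= 1)%E.
Proof.
move=> m3 f1; apply: ge_ereal_sup => _ [x [h [Kxh ->]]]; rewrite lee_fin.
pose d x := g x - l * sqnorm x - f x.
(* The trivial factors and the vanishing summand give the shape of [fdiff_lin]. *)
have -> : (fun y => s^-1 * g y) =
    (fun y => s^-1 * (1 * (1 * f y + 1 * d y) + l * sqnorm y) + 0 * f y).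
  by apply/funext => y; rewrite /d; ring.
rewrite !fdiff_lin fdiff_sqnorm// mulr0 mul0r !addr0 !mul1r.
rewrite normrM gtr0_norm ?invr_gt0// ler_pdivrMl// mulr1.
apply: le_trans (ler_normD _ _) _; apply: lerD; last first.
  by apply: fdiff_le => j jm; exact/gP/Kxh.
rewrite -lee_fin; apply: le_trans f1; apply: ereal_sup_ubound.
by exists x, h.
Qed.

(** A polynomial [p] close to [s^-1 * g] yields [s *: p - l *: sqnorm], of the
same degree bound since [2 <= k], close to [f]. *)
Lemma best_approx_rescale k (r : R) : (2 <= k)%N ->
  (best_approx k (fun x => (s^-1 * g x)%R) K < r%:E)%E ->
  (best_approx k f K <= (s * r + e)%:E)%E.
Proof.
move=> k2 /ereal_inf_lt[_ [p pk <-] pr].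
have [q q2 qE] := peval_sqnorm R n.
apply: (@le_trans _ _ (unorm K (fun x => f x - peval (s *: p - l *: q) x))).
  apply: ereal_inf_lbound; exists (s *: p - l *: q) => //.
  rewrite /polys/=; apply: leq_trans (msizeD_le _ _) _; rewrite geq_max.
  rewrite -scaleNr; apply/andP; split; apply: leq_trans (msizeZ_le _ _) _ => //.
  exact: leq_trans q2 _.
apply: ge_ereal_sup => _ [x Kx <-]; rewrite lee_fin.
have -> : f x - peval (s *: p - l *: q) x =
    s * (s^-1 * g x - peval p x) - (g x - l * sqnorm x - f x).
  rewrite -qE /peval mevalB !mevalZ mulrBr mulVKf ?gt_eqF//; ring.
apply: le_trans (ler_normB _ _) _; apply: lerD; last exact: gP.
rewrite normrM (gtr0_norm s_gt0) ler_pM2l// -lee_fin.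
by apply: le_trans (ltW pr); apply: ereal_sup_ubound; exists x.
Qed.

End Transfer.

(** Rules out the value [-oo] for the convex Whitney constant. *)
Lemma best_approx_ge0 (R : realType) (n k : nat) (K : set 'rV[R]_n) f :
  K !=set0 -> (0 <= best_approx k f K)%E.
Proof.
move=> [x Kx]; apply: le_ereal_inf_tmp => _ [p _ <-].
apply: le_ereal_sup_tmp; exists `|f x - peval p x|%:E; last by rewrite lee_fin.
by exists x.
Qed.

Lemma convex_cont_onZ (R : realType) (n : nat) (K : set 'rV[R]_n) g (a : R) :
  0 <= a -> convex_cont_on K g -> convex_cont_on K (fun x => a * g x).
Proof.
move=> a0 [gcont gconv]; split.
  by move=> x; apply: cvgMr; exact: gcont.
by move=> x y Kx Ky; rewrite -mulrDr mulrCA ler_wpM2l//; exact: gconv.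
Qed.

Theorem theorem1p4 (R : realType) (n : nat) (n_gt0 : (0 < n)%N)
    (K : set 'rV[R]_n) (K_body : convex_body K) (m : nat) (m_ge3 : (3 <= m)%N) :
  convex_whitney m K = whitney m K.
Proof.
case: K_body => Kcpt _ [x0 /interior_subset Kx0].
have K0 : K !=set0 by exists x0.
apply/eqP; rewrite eq_le; apply/andP; split.
  by apply: ereal_sup_le => _ [f [[fcont _] f1] <-]; exists f.
apply: ge_ereal_sup => _ [f [fcont f1] <-].
have approx (d : R) : 0 < d -> exists l g,
    [/\ forall x, K x -> `|g x - l * sqnorm x - f x| <= d &
     (best_approx m.-1 (fun x => ((1 + 2 ^+ m * d)^-1 * g x)%R) K
       <= convex_whitney m K)%E].
  move=> d0; have [l [g [gconv gP]]] := semiconvex_approx K0 Kcpt fcont d0.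
  exists l, g; split=> //; apply: ereal_sup_ubound.
  exists (fun x => (1 + 2 ^+ m * d)^-1 * g x) => //; split.
    apply: convex_cont_onZ gconv.
    by rewrite invr_ge0 addr_ge0// mulr_ge0 ?exprn_ge0// ltW.
  by apply: omega_rescale gP _ _ _ => //; exact: ltW.
have : (0 <= convex_whitney m K)%E.
  have [l [g [_]]] := approx 1 ltr01.
  by apply: le_trans; exact: best_approx_ge0.
case: (convex_whitney m K) approx => [w||] approx; [|by rewrite !leey|by []].
rewrite lee_fin => w0; apply/lee_addgt0Pr => e e0.
(* The excess [e] is split: half goes into [r], strictly above the supremum, and
   [d] is chosen so that [(1 + 2 ^ m * d) * r + d] costs the other half. *)
pose r := w + e / 2.
have r0 : 0 < 1 + 2 ^+ m * r.
  by rewrite ltr_pwDl// mulr_ge0 ?exprn_ge0// addr_ge0// divr_ge0// ltW.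
pose d := e / 2 / (1 + 2 ^+ m * r).
have d0 : 0 < d by rewrite !divr_gt0.
have [l [g [gP gw]]] := approx d d0.
apply: le_trans
  (best_approx_rescale (r := r) gP (ltW d0) _ (le_lt_trans gw _)) _.
- by rewrite -ltnS prednK// (leq_trans _ m_ge3).
- by rewrite lte_fin /r ltrDl divr_gt0.
rewrite -EFinD lee_fin -/r.
suff -> : (1 + 2 ^+ m * d) * r + d = w + e by [].
have : d * (1 + 2 ^+ m * r) = e / 2 by rewrite divfK// gt_eqF.
by rewrite /r; lra.
Qed.
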